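(* Let $0<a<1$. There is a positive constant $K=K(a)$, depending only on $a$, such that the following holds. Let $(\lambda_n)_{n\ge 1}$ be a sequence of real numbers with $a\le\lambda_n<1$ for all $n$ and $\lambda_n\lambda_{n-1}\cdots\lambda_1\to 0$ as $n\to\infty$, let $f_n$, $n\ge 1$, be centred inner functions with $|f_n'(0)|\le\lambda_n$, and put $F_n=f_n\circ\cdots\circ f_1$. Then, with $p=2/a+1$, for every $n\ge 1$, $$|F_n(z)|\le K\,\lambda_n\cdots\lambda_1\,\frac{|z|}{(1-|z|)^{p}},\qquad\text{for } z\in\mathbb{D}.$$
   Context: $\mathbb{D}=\{z\in\mathbb{C}:|z|<1\}$ is the unit disc. An inner function is a function analytic in $\mathbb{D}$, mapping $\mathbb{D}$ into its closure, with non-tangential boundary values of modulus $1$ almost everywhere on $\partial\mathbb{D}$. It is centred if it fixes $0$. *)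

(* Defs.v *)
From HB Require Import structures.
From mathcomp Require Import all_boot all_order all_algebra.
From mathcomp Require Import complex.
From mathcomp Require Import all_classical all_reals all_analysis.

Set Implicit Arguments.
Unset Strict Implicit.
Unset Printing Implicit Defensive.

Import Order.TTheory GRing.Theory Num.Theory.
Import numFieldNormedType.Exports.

Local Open Scope classical_set_scope.
Local Open Scope ring_scope.

(* [R[i]] itself carries no topology in the library; seen as a [numFieldType]
   it inherits the normed-space structure (over itself) of number fields. *)
Definition complexField (R : realType) : numFieldType := R[i].

(* The norm [`|z|] is an element of [complexField R]; [modulus z] is the same
   quantity as an element of [R]. *)
Definition modulus {R : realType} (z : complexField R) : R :=
  ComplexField.Normc.normc z.

Section InnerFunctions.
Context {R : realType}.
Local Notation C := (complexField R).
Implicit Types (f : C -> C) (z w zeta : C).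

Definition unit_disc : set C := [set z | modulus z < 1].

(* The increments in the limit defining [derivable] are complex: this is
   complex differentiability at every point of the disc. *)
Definition analytic_on_disc f := forall z, unit_disc z -> derivable f z 1.

Definition circle_point (t : R) : C := Complex (cos t) (sin t).

(* Non-tangential (Stolz) approach region of aperture [M] at the point [zeta] of
   the unit circle. *)
Definition stolz_region (M : R) zeta : set C :=
  [set z | unit_disc z /\ modulus (z - zeta) < M * (1 - modulus z)].

Definition nontangential_limit f zeta w :=
  forall M : R, 1 < M ->
    f z @[z --> within (stolz_region M zeta) (nbhs zeta)] --> w.

(* Functions are total on [C], but only their values on the disc are
   constrained. The null subsets of the circle are those whose preimage under
   the 2pi-periodic parametrisation [circle_point] is Lebesgue-null in [R]. *)
Definition inner_function f :=
  [/\ analytic_on_disc f,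
      f @` unit_disc `<=` closure unit_disc &
      {ae (@lebesgue_measure R), forall t : R, exists w : C,
         modulus w = 1 /\ nontangential_limit f (circle_point t) w}].

Definition centred f := f 0 = 0.

End InnerFunctions.

(* [compose_upto f n] is [f n \o ... \o f 1]; the term [f 0] is not used. *)
Fixpoint compose_upto {T : Type} (f : nat -> T -> T) (n : nat) : T -> T :=
  if n is m.+1 then f m.+1 \o compose_upto f m else id.

(* Main.v *)
Require Import Defs.
From HB Require Import structures.
From mathcomp Require Import all_boot all_order all_algebra.
From mathcomp Require Import complex.
From mathcomp Require Import all_classical all_reals all_analysis.
From mathcomp Require Import ring lra.

(** The functions Psi(x) = x / (1 - x)^p, p = 2/a + 1, absorb the distortion:
    every centred inner f with |f'(0)| <= l satisfies Psi(|f z|) <= l Psi(|z|)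
    as soon as l >= a, and iterating this gives the bound with K = 1, since
    x <= Psi(x).

    The growth estimate behind it is
      |f z| <= |z| (1 - (1 - l) (1 - |z|) / (1 + |z|)),
    which is Harnack's inequality for 1 / rho - Re (beta f(z) / z), |beta| = 1,
    in the disc of radius rho, with rho -> 1.  Harnack's inequality comes from
    the Poisson formula, i.e. from the mean value property of
    (G(z) - G(w)) z (rho^2 - |w|^2) / ((z - w) (rho^2 - w^* z)).  This function
    is continuous, but at 0 and w it need not be differentiable: the mean over
    the circle of radius r is continuous in r, so finitely many exceptional
    radii do no harm.  On an annulus of holomorphy the mean is constant by
    Goursat's bisection argument, carried out in polar coordinates. *)

Set Implicit Arguments.
Unset Strict Implicit.
Unset Printing Implicit Defensive.

Import Order.TTheory GRing.Theory Num.Theory.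
Import numFieldNormedType.Exports.

Local Open Scope classical_set_scope.
Local Open Scope ring_scope.

Local Notation Re := complex.Re.
Local Notation Im := complex.Im.

(** * Bisection *)

(** Goursat's argument for an abstract rectangle function: were [J] nonzero on the whole rectangle,
    repeated quartering would keep selecting a quarter on which [|J|] is at least a fixed multiple
    of the squared size. At the common point of the selected quarters the local bound contradicts
    this. *)
Lemma goursat_bisection (R : realType) (J : R -> R -> R -> R -> R)
    (x1 x2 y1 y2 : R) : x1 < x2 -> y1 < y2 ->
  (forall a b c d e, x1 <= a -> a < b -> b < c -> c <= x2 ->
     y1 <= d -> d < e -> e <= y2 -> J a c d e = J a b d e + J b c d e) ->
  (forall a b c d e, x1 <= a -> a < b -> b <= x2 ->
     y1 <= c -> c < d -> d < e -> e <= y2 -> J a b c e = J a b c d + J a b d e) ->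
  (forall x y eps, x1 <= x <= x2 -> y1 <= y <= y2 -> 0 < eps ->
     exists2 del, 0 < del & forall a b c d, x1 <= a -> a <= x <= b -> b <= x2 ->
       y1 <= c -> c <= y <= d -> d <= y2 -> a < b -> c < d ->
       b - a < del -> d - c < del ->
       `|J a b c d| <= eps * (b - a + (d - c)) ^+ 2) ->
  J x1 x2 y1 y2 = 0.
Proof.
move=> x12 y12 Jx Jy Jloc; apply/eqP/negP => /negP J0.
pose l n := (x2 - x1) / 2 ^+ n; pose m n := (y2 - y1) / 2 ^+ n.
have l0 n : 0 < l n by rewrite divr_gt0 ?subr_gt0 ?exprn_gt0.
have m0 n : 0 < m n by rewrite divr_gt0 ?subr_gt0 ?exprn_gt0.
have pow2 n : (2 ^+ n : R) != 0 by rewrite expf_neq0.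
have lS n : l n = l n.+1 + l n.+1 by rewrite /l exprS; field; rewrite pow2.
have mS n : m n = m n.+1 + m n.+1 by rewrite /m exprS; field; rewrite pow2.
have l00 : l 0%N = x2 - x1 by rewrite /l expr0 divr1.
have m00 : m 0%N = y2 - y1 by rewrite /m expr0 divr1.
have small e : 0 < e -> exists2 n, l n < e & m n < e.
  move=> e0; have [k kP] : exists k : nat, (x2 - x1 + (y2 - y1)) / e < k%:R.
    by exists (Num.truncn ((x2 - x1 + (y2 - y1)) / e)).+1; apply: truncnS_gt.
  have kk : (x2 - x1 + (y2 - y1)) / e < 2 ^+ k.
    by apply: lt_le_trans kP _; rewrite -natrX ler_nat ltnW // ltn_expl.
  rewrite ltr_pdivrMr // in kk.
  by exists k; rewrite /l /m ltr_pdivrMr ?exprn_gt0 //; lra.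
clearbody l m.
(* [kap] is the ratio of [|J|] to the squared sum of the two sides; the selection below never lets
   this ratio drop. *)
have [kap kap0 kapE] : exists2 kap, 0 < kap &
    `|J x1 x2 y1 y2| = kap * (x2 - x1 + (y2 - y1)) ^+ 2.
  exists (`|J x1 x2 y1 y2| / (x2 - x1 + (y2 - y1)) ^+ 2).
    by rewrite divr_gt0 ?normr_gt0 ?exprn_gt0 // addr_gt0 ?subr_gt0.
  by rewrite divfK // expf_neq0 // gt_eqF // addr_gt0 ?subr_gt0.
(* [q] is the lower left corner of a candidate rectangle of generation [n], with sides [l n] and
   [m n]. *)
pose P n (q : R * R) := [/\ x1 <= q.1, q.1 + l n <= x2, y1 <= q.2, q.2 + m n <= y2 &
  kap * (l n + m n) ^+ 2 <= `|J q.1 (q.1 + l n) q.2 (q.2 + m n)|].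
have P0 : P 0%N (x1, y1).
  have ex : x1 + l 0%N = x2 by rewrite l00; ring.
  have ey : y1 + m 0%N = y2 by rewrite m00; ring.
  by split; rewrite /= ?ex ?ey // l00 m00 kapE.
have step n q : P n q -> exists q', P n.+1 q' /\
    [/\ q.1 <= q'.1, q'.1 + l n.+1 <= q.1 + l n,
        q.2 <= q'.2 & q'.2 + m n.+1 <= q.2 + m n].
  case: q => a c [/= a1 a2 c1 c2 Jk].
  have := l0 n.+1; have := m0 n.+1; have lSn := lS n; have mSn := mS n => mp lp.
  have Ex : a + l n.+1 + l n.+1 = a + l n by rewrite lSn addrA.
  have Ey : c + m n.+1 + m n.+1 = c + m n by rewrite mSn addrA.
  have E1 : J a (a + l n) c (c + m n) =
      J a (a + l n.+1) c (c + m n.+1) + J a (a + l n.+1) (c + m n.+1) (c + m n)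
    + (J (a + l n.+1) (a + l n) c (c + m n.+1)
       + J (a + l n.+1) (a + l n) (c + m n.+1) (c + m n)).
    rewrite (Jx a (a + l n.+1)); try lra.
    rewrite (Jy a (a + l n.+1) c (c + m n.+1)); try lra.
    rewrite (Jy (a + l n.+1) (a + l n) c (c + m n.+1)); lra.
  (* Halving both sides divides the squared size by four, so the four values of [|J|] cannot all lie
     below [K]. *)
  have Esq : (l n + m n) ^+ 2 = 4 * (l n.+1 + m n.+1) ^+ 2 by rewrite lSn mSn; ring.
  have := Jk; rewrite E1 Esq mulrCA.
  set K := kap * _; set A1 := J _ _ _ _; set A2 := J _ _ _ _.
  set A3 := J _ _ _ _; set A4 := J _ _ _ _ => Jk'.
  have : K <= `|A1| \/ K <= `|A2| \/ K <= `|A3| \/ K <= `|A4|.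
    have := ler_normD (A1 + A2) (A3 + A4); have := ler_normD A1 A2.
    have := ler_normD A3 A4.
    have [|k1] := leP K `|A1|; first by left.
    have [|k2] := leP K `|A2|; first by right; left.
    have [|k3] := leP K `|A3|; first by do 2 right; left.
    have [|k4] := leP K `|A4|; first by do 3 right.
    lra.
  move=> [|[|[|]]] HK; [exists (a, c)|exists (a, c + m n.+1)|
    exists (a + l n.+1, c)|exists (a + l n.+1, c + m n.+1)];
    (split; [split; rewrite /= ?Ex ?Ey //; lra|split; rewrite /= ?Ex ?Ey; lra]).
(* Dependent choice asks for a successor of every pair, hence the implication: a pair that violates
   [P] gets a dummy successor. *)
pose Q (s t : nat * (R * R)) := t.1 = s.1.+1 /\ (P s.1 s.2 -> P t.1 t.2 /\
    [/\ s.2.1 <= t.2.1, t.2.1 + l t.1 <= s.2.1 + l s.1,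
        s.2.2 <= t.2.2 & t.2.2 + m t.1 <= s.2.2 + m s.1]).
have [|u [u0 uQ]] := @dependent_choice _ Q _ (0%N, (x1, y1)).
  move=> [n q]; have [Pq|nPq] := pselect (P n q).
    by have [q' q'P] := cid (step _ _ Pq); exists (n.+1, q').
  by exists (n.+1, q); split.
have u1 n : (u n).1 = n by elim: n => [|n IH]; rewrite ?u0 //; have [-> _] := uQ n; rewrite IH.
pose a n := (u n).2.1; pose c n := (u n).2.2.
have Pu n : P n (u n).2.
  elim: n => [|n IH]; first by rewrite u0.
  by have [_] := uQ n; rewrite !u1 => /(_ IH)[].
have mono n : [/\ a n <= a n.+1, a n.+1 + l n.+1 <= a n + l n,
    c n <= c n.+1 & c n.+1 + m n.+1 <= c n + m n].
  by have [_] := uQ n; rewrite !u1 => /(_ (Pu n))[].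
have amono n k : [/\ a n <= a (n + k)%N, a (n + k)%N + l (n + k)%N <= a n + l n,
    c n <= c (n + k)%N & c (n + k)%N + m (n + k)%N <= c n + m n].
  elim: k => [|k [i1 i2 i3 i4]]; first by rewrite addn0 !lexx.
  rewrite addnS; have [j1 j2 j3 j4] := mono (n + k)%N.
  by split; [exact: le_trans j1|exact: le_trans i2|exact: le_trans j3|exact: le_trans i4].
have nest n k : [/\ a k <= a n + l n & c k <= c n + m n].
  have [_ i2 _ i4] := amono n k; have [j1 _ j3 _] := amono k n.
  rewrite addnC in j1 j3; have := l0 (n + k)%N; have := m0 (n + k)%N; split; lra.
(* The suprema of the left edges and of the lower edges are the coordinates of a point common to all
   selected rectangles. *)
have [xa xl] : (forall n, a n <= sup (range a)) /\ (forall n, sup (range a) <= a n + l n).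
  split=> n.
    apply: ub_le_sup; last by exists n.
    by exists (a 0 + l 0) => _ [k _ <-]; have [] := nest 0%N k.
  by apply: sup_le_ub; [exists (a 0); exists 0%N|move=> _ [k _ <-]; have [] := nest n k].
have [yc ym] : (forall n, c n <= sup (range c)) /\ (forall n, sup (range c) <= c n + m n).
  split=> n.
    apply: ub_le_sup; last by exists n.
    by exists (c 0 + m 0) => _ [k _ <-]; have [] := nest 0%N k.
  by apply: sup_le_ub; [exists (c 0); exists 0%N|move=> _ [k _ <-]; have [] := nest n k].
have [p1 p2 p3 p4 _] := Pu 0%N.
(* With [kap / 2] as local constant, a small selected rectangle would have ratio both at most
   [kap / 2] and at least [kap]. *)
have [|||del del0 Hdel] := Jloc (sup (range a)) (sup (range c)) (kap / 2).
- by have := xa 0%N; have := xl 0%N; rewrite /a => ? ?; apply/andP; split; lra.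
- by have := yc 0%N; have := ym 0%N; rewrite /c => ? ?; apply/andP; split; lra.
- by rewrite divr_gt0.
have [n ln mn] := small _ del0.
have [q1 q2 q3 q4 q5] := Pu n.
have := Hdel (a n) (a n + l n) (c n) (c n + m n).
have := l0 n; have := m0 n => mn0 ln0.
have El : a n + l n - a n = l n by ring.
have Em : c n + m n - c n = m n by ring.
rewrite El Em xa xl yc ym => /(_ q1 isT q2 q3 isT q4).
rewrite !ltrDl => /(_ ln0 mn0 ln mn) H.
have := le_trans q5 H; rewrite ler_pM2r ?exprn_gt0 ?addr_gt0 //; lra.
Qed.

(** * Integrals of continuous functions over segments *)

Section interval_integral.
Context {R : realType}.
Implicit Types (f g F : R -> R) (a b c M : R).
Local Notation mu := (@lebesgue_measure R).
Local Notation "'integral' a b f" := (\int[mu]_(x in `[a, b]) f x)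
  (at level 10, a, b, f at level 9).

(** Continuity is meant in the whole line, also at the endpoints, so it follows by plain composition
    from pointwise continuity in the plane. *)
Definition continuous_on_itv a b f := forall x, a <= x <= b -> {for x, continuous f}.

Lemma continuous_on_itv_within a b f :
  continuous_on_itv a b f -> {within `[a, b], continuous f}.
Proof.
move=> cf; apply: continuous_in_subspaceT => x.
by rewrite inE /= in_itv /= => /cf.
Qed.

Lemma continuous_on_itv_integrable a b f :
  continuous_on_itv a b f -> mu.-integrable `[a, b] (EFin \o f).
Proof.
move=> cf; apply: continuous_compact_integrable; first exact: segment_compact.
exact: continuous_on_itv_within.
Qed.

Lemma Rintegral_itv_split a b c f : a <= c -> c <= b -> continuous_on_itv a b f ->
  integral a b f = integral a c f + integral c b f.
Proof.
move=> ac cb cf; have fi := continuous_on_itv_integrable cf.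
apply/eqP; rewrite addrC -subr_eq; apply/eqP.
rewrite (@Rintegral_itvB _ f (BLeft a) (BRight b) c) ?bnd_simp //.
apply: Rintegral_itv_obnd_cbnd.
apply: (integrableS _ _ _ fi) => // x /=; rewrite !in_itv /= => /andP[/ltW cx ->].
by rewrite (le_trans ac cx).
Qed.

Lemma Rintegral_itv_cst a b c : a <= b -> integral a b (fun=> c) = c * (b - a).
Proof.
move=> ab; rewrite Rintegral_cst //= lebesgue_measure_itv /= lte_fin.
move: ab; rewrite le_eqVlt => /predU1P[->|ab]; first by rewrite ltxx subrr mulr0.
by rewrite ab.
Qed.

Lemma continuous_on_itv_cst a b c : continuous_on_itv a b (fun=> c).
Proof. by move=> x _; exact: cst_continuous. Qed.

Lemma le_Rintegral_itv a b f g : continuous_on_itv a b f -> continuous_on_itv a b g ->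
  (forall x, a <= x <= b -> f x <= g x) -> integral a b f <= integral a b g.
Proof.
by move=> cf cg fg; apply: le_Rintegral => //; exact: continuous_on_itv_integrable.
Qed.

Lemma Rintegral_itv_norm_le a b f M : a <= b -> continuous_on_itv a b f ->
  (forall x, a <= x <= b -> `|f x| <= M) -> `|integral a b f| <= M * (b - a).
Proof.
move=> ab cf fM; rewrite ler_norml -mulNr -!Rintegral_itv_cst //.
have fM' x : a <= x <= b -> - M <= f x <= M by move=> /fM; rewrite ler_norml.
apply/andP; split; apply: le_Rintegral_itv => //; try exact: continuous_on_itv_cst.
  by move=> x /fM'/andP[].
by move=> x /fM'/andP[].
Qed.

Lemma Rintegral_itv_FTC a b f F : a < b -> continuous_on_itv a b f ->
  (forall x : R, is_derive x 1 F (f x)) -> integral a b f = F b - F a.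
Proof.
move=> ab cf dF.
have cF : continuous F.
  by move=> x; apply/differentiable_continuous/derivable1_diffP; exact: ex_derive.
rewrite /Rintegral (@continuous_FTC2 _ f F) //.
- exact: continuous_on_itv_within.
- split; first by move=> x _; exact: ex_derive.
  + exact: cvg_at_right_filter (cF a).
  + exact: cvg_at_left_filter (cF b).
- by move=> x _; rewrite derive1E derive_val.
Qed.

End interval_integral.

(** * The complex plane and polar coordinates *)

Section complex_plane.
Context {R : realType}.
Local Notation C := (complexField R).
Implicit Types (z w : C) (r s t u e : R).

Lemma norm_modulus z : `|z| = ((modulus z)%:C)%C :> C.
Proof. by case: z. Qed.

Lemma modulus_ge0 z : 0 <= modulus z.
Proof. by case: z => x y; exact: sqrtr_ge0. Qed.

Lemma modulus0 : modulus (0 : C) = 0.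
Proof. exact: ComplexField.Normc.normc0. Qed.

Lemma modulusM z w : modulus (z * w) = modulus z * modulus w.
Proof. exact: ComplexField.Normc.normcM. Qed.

Lemma modulusV z : modulus z^-1 = (modulus z)^-1.
Proof. exact: ComplexField.Normc.normcV. Qed.

Lemma modulusN z : modulus (- z) = modulus z.
Proof. exact: (@normcN R z). Qed.

Lemma modulusD z w : modulus (z + w) <= modulus z + modulus w.
Proof. exact: (@le_normcD R z w). Qed.

Lemma modulusBC z w : modulus (z - w) = modulus (w - z).
Proof. by rewrite -modulusN opprB. Qed.

Lemma modulus_eq0 z : (modulus z == 0) = (z == 0).
Proof.
apply/eqP/eqP => [|->]; last exact: modulus0.
exact: ComplexField.Normc.eq0_normc.
Qed.

Lemma modulus_gt0 z : (0 < modulus z) = (z != 0).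
Proof. by rewrite lt_def modulus_ge0 andbT modulus_eq0. Qed.

Lemma modulus_sq z : modulus z ^+ 2 = Re z ^+ 2 + Im z ^+ 2.
Proof. by case: z => x y; rewrite /modulus /= sqr_sqrtr // addr_ge0 ?sqr_ge0. Qed.

Lemma ReB z w : Re (z - w) = Re z - Re w.
Proof. by case: z w => x y [x' y']. Qed.

Lemma ImB z w : Im (z - w) = Im z - Im w.
Proof. by case: z w => x y [x' y']. Qed.

Lemma normr_Re_le z : `|Re z| <= modulus z.
Proof.
rewrite -(ler_pXn2r (ltn0Sn 1)) ?nnegrE ?modulus_ge0 //.
by rewrite modulus_sq real_normK ?num_real // lerDl sqr_ge0.
Qed.

Lemma normr_Im_le z : `|Im z| <= modulus z.
Proof.
rewrite -(ler_pXn2r (ltn0Sn 1)) ?nnegrE ?modulus_ge0 //.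
by rewrite modulus_sq real_normK ?num_real // lerDr sqr_ge0.
Qed.

Lemma modulus_real (x : R) : modulus (x%:C%C : C) = `|x|.
Proof. by rewrite /modulus /= expr0n /= addr0 sqrtr_sqr. Qed.

Lemma modulus_Complex_le (x y : R) : modulus (Complex x y : C) <= `|x| + `|y|.
Proof.
have -> : (Complex x y : C) = (x%:C%C : C) + (Complex 0 y : C).
  by rewrite /GRing.add /= add0r addr0.
apply: le_trans (modulusD _ _) _; rewrite modulus_real lerD2l.
by rewrite /modulus /= expr0n /= add0r sqrtr_sqr.
Qed.

Lemma ltr_modulus z e : (`|z| < (e%:C)%C :> C) = (modulus z < e).
Proof. by rewrite norm_modulus; exact: ltcR. Qed.

(** Balls of [complexField R] have radii in the field itself. A positive radius has zero imaginary
    part, so real radii suffice. *)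
Lemma nbhs_modulusP z (P : set C) :
  nbhs z P <-> exists2 e, 0 < e & forall w, modulus (w - z) < e -> P w.
Proof.
split=> [/nbhs_ballP[e /= e0 eP]|[e e0 eP]].
  have [Ie Re0] : Im e = 0 /\ 0 < Re e.
    by move: e0; rewrite ltcE /= => /andP[/eqP -> ->].
  exists (Re e) => // w wz; apply: eP; rewrite -ball_normE /=.
  have -> : e = ((Re e)%:C)%C :> C by case: (e) Ie => x y /= ->.
  by rewrite ltr_modulus modulusBC.
apply/nbhs_ballP; exists ((e%:C)%C : C); first by rewrite /= ltcR.
by move=> w; rewrite -ball_normE /= ltr_modulus => wz; apply: eP; rewrite modulusBC.
Qed.

Lemma cvg_modulusP (T : Type) (F : set_system T) (FF : Filter F) (f : T -> C) z :
  f @ F --> z <-> forall e, 0 < e -> \forall x \near F, modulus (f x - z) < e.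
Proof.
split=> [fz e e0|fz P /nbhs_modulusP[e e0 eP]].
  by apply: (fz [set w | modulus (w - z) < e]); apply/nbhs_modulusP; exists e.
by near=> x; apply: eP; near: x; exact: fz.
Unshelve. all: by end_near. Qed.

Lemma Re_continuous : continuous (fun z => Re z : R).
Proof.
move=> z; apply/(@cvgrPdist_lt R R C (nbhs z) _ (fun z => Re z : R)) => e e0.
apply/nbhs_modulusP; exists e => // w wz.
apply: le_lt_trans wz; rewrite distrC -ReB.
exact: normr_Re_le.
Qed.

Lemma Im_continuous : continuous (fun z => Im z : R).
Proof.
move=> z; apply/(@cvgrPdist_lt R R C (nbhs z) _ (fun z => Im z : R)) => e e0.
apply/nbhs_modulusP; exists e => // w wz.
apply: le_lt_trans wz; rewrite distrC -ImB.
exact: normr_Im_le.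
Qed.

Lemma cvg_Complex (T : Type) (F : set_system T) (FF : Filter F) (f g : T -> R) (x y : R) :
  f @ F --> x -> g @ F --> y -> (fun v => Complex (f v) (g v) : C) @ F --> (Complex x y : C).
Proof.
move=> fx gy; apply/cvg_modulusP => e e0.
have e2 : 0 < e / 2 by rewrite divr_gt0.
near=> v; apply: le_lt_trans (modulus_Complex_le (f v - x) (g v - y)) _.
rewrite [e]splitr ltrD // distrC; near: v.
  by move/cvgrPdist_lt : fx; exact.
by move/cvgrPdist_lt : gy; exact.
Unshelve. all: by end_near. Qed.

Definition polar r t : C := Complex (r * cos t) (r * sin t).

Lemma modulus_polar r t : 0 <= r -> modulus (polar r t) = r.
Proof.
move=> r0; rewrite /polar /modulus /= !exprMn -mulrDr cos2Dsin2 mulr1.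
by rewrite sqrtr_sqr ger0_norm.
Qed.

Lemma polar_continuous (p : R * R) :
  (fun q : R * R => polar q.1 q.2) @ p --> polar p.1 p.2.
Proof.
apply: cvg_Complex; apply: cvgM; try exact: cvg_fst.
  by apply: (@continuous_comp _ _ _ snd cos); [exact: cvg_snd|exact: continuous_cos].
by apply: (@continuous_comp _ _ _ snd sin); [exact: cvg_snd|exact: continuous_sin].
Qed.

Lemma derive_le1_lipschitz (F f : R -> R) t u : (forall x : R, is_derive x 1 F (f x)) ->
  (forall x, `|f x| <= 1) -> `|F t - F u| <= `|t - u|.
Proof.
move=> dF f1; wlog ut : t u / u < t => [H|].
  have [/H //|/H|->] := ltgtP u t; last by rewrite !subrr.
  by rewrite distrC [in leRHS]distrC.
have [|x _ ->] := @MVT R F f u t ut (fun x _ => dF x).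
  apply: derivable_within_continuous => x _; exact: ex_derive.
by rewrite normrM ler_piMl.
Qed.

(** One moves along the ray at angle [t], then along the circle of radius [s]. The factor 2 comes
    from adding the Lipschitz bounds of [cos] and [sin]. *)
Lemma modulus_polarB_le r s t u : 0 <= s ->
  modulus (polar r t - polar s u) <= `|r - s| + 2 * s * `|t - u|.
Proof.
move=> s0.
have -> : polar r t - polar s u = polar (r - s) t
    + Complex (s * (cos t - cos u)) (s * (sin t - sin u)) :> C.
  by apply/eqP; rewrite eq_complex /=; apply/andP; split; apply/eqP; ring.
apply: le_trans (modulusD _ _) _; apply: lerD.
  rewrite /polar /modulus /= !exprMn -mulrDr cos2Dsin2 mulr1.
  by rewrite sqrtr_sqr.
apply: le_trans (modulus_Complex_le _ _) _.
rewrite !normrM (ger0_norm s0) -mulrDr -mulrA mulrCA ler_wpM2l //.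
have c : `|cos t - cos u| <= `|t - u|.
  apply: (@derive_le1_lipschitz _ (fun x => - sin x)) => x.
  by rewrite normrN sin_max.
have d : `|sin t - sin u| <= `|t - u|.
  by apply: (@derive_le1_lipschitz _ cos) => x; rewrite cos_max.
lra.
Qed.

Lemma derivable_modulusP (h : C -> C) z : derivable h z 1 ->
  forall e, 0 < e -> exists2 d, 0 < d & forall w, modulus (w - z) < d ->
    modulus (h w - h z - h^`()%classic z * (w - z)) <= e * modulus (w - z).
Proof.
rewrite derive1E => dh e e0; set c := 'D_1 h z.
have /cvg_modulusP/(_ e e0) : (fun y => y^-1 *: ((h \o shift z) (y *: (1 : C)) - h z))
    @ 0^' --> c by exact: dh.
move=> /nbhs_modulusP[d d0 dP]; exists d => // w wz.
have [->|wz0] := eqVneq w z; first by rewrite !subrr mulr0 subr0 modulus0 mulr0.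
have wz1 : w - z != 0 by rewrite subr_eq0.
have := dP (w - z); rewrite subr0 => /(_ wz wz1) /=.
rewrite /GRing.scale /= mulr1 subrK => H.
have -> : h w - h z - c * (w - z) = (w - z) * ((w - z)^-1 * (h w - h z) - c).
  by rewrite [RHS]mulrBr mulVKf // [c * _]mulrC.
by rewrite modulusM mulrC ler_wpM2r ?modulus_ge0 // ltW.
Qed.

Lemma derivable_continuous (h : C -> C) z : derivable h z 1 -> {for z, continuous h}.
Proof. by move/derivable1_diffP; exact: differentiable_continuous. Qed.

End complex_plane.

(** * Means over circles *)

Section circle_means.
Context {R : realType}.
Local Notation C := (complexField R).
Implicit Types (h k : C -> C) (z w : C) (r s t u a b c d e : R).
Local Notation "'integral' a b f" := (\int[@lebesgue_measure R]_(x in `[a, b]) f x)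
  (at level 10, a, b, f at level 9).

Lemma polar_continuous_radius t : continuous (fun r => polar r t).
Proof.
by move=> r; apply: cvg_Complex; apply: cvgM; try exact: cvg_cst; exact: cvg_id.
Qed.

Lemma polar_continuous_angle r : continuous (polar r).
Proof.
move=> t; apply: cvg_Complex; apply: cvgM; try exact: cvg_cst.
  exact: continuous_cos.
exact: continuous_sin.
Qed.

(** For [r1 = 0] this is the closed disc of radius [r2]. Continuity holds across the bounding
    circles as well. *)
Definition continuous_on_annulus r1 r2 h :=
  forall z, r1 <= modulus z <= r2 -> {for z, continuous h}.

Lemma continuous_on_circle_Re r1 r2 h r a b : 0 <= r1 -> r1 <= r <= r2 ->
  continuous_on_annulus r1 r2 h -> continuous_on_itv a b (fun t => Re (h (polar r t))).
Proof.
move=> r10 /andP[r1r rr2] ch t _.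
have ct : {for polar r t, continuous h}.
  by apply: ch; rewrite modulus_polar ?(le_trans r10) // r1r rr2.
apply: (@continuous_comp _ _ _ (polar r) (fun z => Re (h z))).
  exact: polar_continuous_angle.
exact: (continuous_comp ct (@Re_continuous R _)).
Qed.

Lemma continuous_on_radius_Im r1 r2 h t a b : 0 < r1 -> r1 <= a -> b <= r2 ->
  continuous_on_annulus r1 r2 h ->
  continuous_on_itv a b (fun r => Im (h (polar r t)) / r).
Proof.
move=> r10 r1a br2 ch r /andP[ar rb].
have r0 : 0 < r by rewrite (lt_le_trans r10) // (le_trans r1a).
have ct : {for polar r t, continuous h}.
  by apply: ch; rewrite modulus_polar ?(ltW r0) // (le_trans r1a) ?(le_trans rb).
apply: cvgM; last by apply: cvgV; [rewrite gt_eqF|exact: cvg_id].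
apply: (@continuous_comp _ _ _ (fun r => polar r t) (fun z => Im (h z))).
  exact: polar_continuous_radius.
exact: (continuous_comp ct (@Im_continuous R _)).
Qed.

(** The real part of the integral of [h(z) dz / (i z)] along the boundary of the
    polar rectangle [a <= r <= b], [c <= t <= d]. *)
Definition sector_flux h a b c d : R :=
  integral c d (fun t => Re (h (polar b t))) - integral c d (fun t => Re (h (polar a t)))
  - (integral a b (fun r => Im (h (polar r d)) / r)
     - integral a b (fun r => Im (h (polar r c)) / r)).

(** * Additivity, size and vanishing on affine functions of the flux *)

Section flux.
Variables (r1 r2 : R).
Hypothesis r10 : 0 < r1.

(** The integrals over the common arc of radius [b] cancel, and those along the radial sides add
    up. *)
Lemma sector_flux_split_radius h a b c d e : continuous_on_annulus r1 r2 h ->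
  r1 <= a -> a < b -> b < c -> c <= r2 ->
  sector_flux h a c d e = sector_flux h a b d e + sector_flux h b c d e.
Proof.
move=> ch r1a /ltW ab /ltW bc cr2; rewrite /sector_flux.
rewrite (Rintegral_itv_split ab bc (continuous_on_radius_Im r10 r1a cr2 ch)).
rewrite (Rintegral_itv_split ab bc (continuous_on_radius_Im r10 r1a cr2 ch)).
ring.
Qed.

(** Here the integrals along the common ray at angle [d] cancel. *)
Lemma sector_flux_split_angle h a b c d e : continuous_on_annulus r1 r2 h ->
  r1 <= a -> a <= b -> b <= r2 -> c < d -> d < e ->
  sector_flux h a b c e = sector_flux h a b c d + sector_flux h a b d e.
Proof.
move=> ch r1a ab br2 /ltW cd /ltW de; rewrite /sector_flux.
have ha : r1 <= a <= r2 by rewrite r1a (le_trans ab).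
have hb : r1 <= b <= r2 by rewrite br2 (le_trans r1a).
rewrite (Rintegral_itv_split cd de (continuous_on_circle_Re (ltW r10) ha ch)).
rewrite (Rintegral_itv_split cd de (continuous_on_circle_Re (ltW r10) hb ch)).
ring.
Qed.

Lemma sector_fluxB h k a b c d : continuous_on_annulus r1 r2 h ->
  continuous_on_annulus r1 r2 k -> r1 <= a -> a <= b -> b <= r2 ->
  sector_flux (fun z => h z - k z) a b c d = sector_flux h a b c d - sector_flux k a b c d.
Proof.
move=> ch ck r1a ab br2; rewrite /sector_flux.
have ha : r1 <= a <= r2 by rewrite r1a (le_trans ab).
have hb : r1 <= b <= r2 by rewrite br2 (le_trans r1a).
have EU r : r1 <= r <= r2 -> integral c d (fun t => Re (h (polar r t) - k (polar r t))) =
    integral c d (fun t => Re (h (polar r t))) - integral c d (fun t => Re (k (polar r t))).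
  move=> hr; rewrite -RintegralB //.
  - by apply: eq_Rintegral => t _; rewrite ReB.
  - exact/continuous_on_itv_integrable/(continuous_on_circle_Re (ltW r10) hr ch).
  - exact/continuous_on_itv_integrable/(continuous_on_circle_Re (ltW r10) hr ck).
have EV t : integral a b (fun r => Im (h (polar r t) - k (polar r t)) / r) =
    integral a b (fun r => Im (h (polar r t)) / r)
    - integral a b (fun r => Im (k (polar r t)) / r).
  rewrite -RintegralB //.
  - by apply: eq_Rintegral => r _; rewrite ImB mulrBl.
  - exact/continuous_on_itv_integrable/(continuous_on_radius_Im r10 r1a br2 ch).
  - exact/continuous_on_itv_integrable/(continuous_on_radius_Im r10 r1a br2 ck).
rewrite !EU // !EV; ring.
Qed.

Lemma sector_flux_le h a b c d M : continuous_on_annulus r1 r2 h ->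
  r1 <= a -> a <= b -> b <= r2 -> c <= d ->
  (forall r t, a <= r <= b -> c <= t <= d -> modulus (h (polar r t)) <= M) ->
  `|sector_flux h a b c d| <= 2 * (M * (d - c)) + 2 * (M / r1 * (b - a)).
Proof.
move=> ch r1a ab br2 cd hM; rewrite /sector_flux.
have ha : r1 <= a <= r2 by rewrite r1a (le_trans ab).
have hb : r1 <= b <= r2 by rewrite br2 (le_trans r1a).
have EU r : a <= r <= b -> r1 <= r <= r2 ->
    `|integral c d (fun t => Re (h (polar r t)))| <= M * (d - c).
  move=> rab rr; apply: Rintegral_itv_norm_le => //.
    exact: continuous_on_circle_Re (ltW r10) rr ch.
  by move=> t tcd; apply: le_trans (normr_Re_le _) _; exact: hM.
have EV t : c <= t <= d -> `|integral a b (fun r => Im (h (polar r t)) / r)| <= M / r1 * (b - a).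
  move=> tcd; apply: Rintegral_itv_norm_le => //.
    exact: continuous_on_radius_Im r10 r1a br2 ch.
  move=> r /andP[ar rb]; have r1r : r1 <= r by rewrite (le_trans r1a).
  have r0 : 0 < r by rewrite (lt_le_trans r10).
  rewrite normrM normfV (gtr0_norm r0); apply: ler_pM => //.
  - by rewrite invr_ge0 ltW.
  - by apply: le_trans (normr_Im_le _) _; apply: hM => //; rewrite ar rb.
  - by rewrite lef_pV2.
have := EU a; have := EU b; have := EV c; have := EV d.
rewrite !lexx ab cd => /(_ isT) V2 /(_ isT) V1 /(_ isT hb) U2 /(_ isT ha) U1.
apply: le_trans (ler_normB _ _) _.
apply: lerD; apply: le_trans (ler_normB _ _) _; lra.
Qed.

(** Goursat's argument needs this only for affine functions, where all four integrals are
    explicit. *)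
Lemma sector_flux_affine (k0 c0 : C) a b c d : r1 <= a -> a <= b -> b <= r2 -> c < d ->
  sector_flux (fun z => k0 + c0 * z) a b c d = 0.
Proof.
move=> r1a ab br2 cd; rewrite /sector_flux.
have ck : continuous_on_annulus r1 r2 (fun z => k0 + c0 * z).
  move=> z _; apply: derivable_continuous; apply: derivableD.
    exact: derivable_cst.
  by apply: derivableM; [exact: derivable_cst|exact: derivable_id].
have ha : r1 <= a <= r2 by rewrite r1a (le_trans ab).
have hb : r1 <= b <= r2 by rewrite br2 (le_trans r1a).
rewrite -[X in _ - _ - X]RintegralB //; last 2 first.
- exact/continuous_on_itv_integrable/(continuous_on_radius_Im r10 r1a br2 ck).
- exact/continuous_on_itv_integrable/(continuous_on_radius_Im r10 r1a br2 ck).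
case: c0 k0 ck => x y [p q] ck.
(* [F r] is an antiderivative in [t] of the real part on the circle of radius [r]. *)
pose F r t := t * p + r * (x * sin t + y * cos t).
have EU r : r1 <= r <= r2 ->
    integral c d (fun t => Re (Complex p q + Complex x y * polar r t : C)) = F r d - F r c.
  move=> hr; apply: Rintegral_itv_FTC => //.
    exact: continuous_on_circle_Re (ltW r10) hr ck.
  move=> t; rewrite /F /=; apply: is_derive_eq.
  rewrite /GRing.scale /=; ring.
rewrite !EU //.
(* The terms [q / r] at the angles [d] and [c] cancel, so the difference of the radial integrands
   does not depend on [r]. *)
rewrite (@eq_Rintegral _ _ _ _ _ (fun=> x * sin d + y * cos d - (x * sin c + y * cos c))).
  by rewrite Rintegral_itv_cst // /F; ring.
move=> r; rewrite inE /= in_itv /= => /andP[ar _].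
have r0 : r != 0 by rewrite gt_eqF // (lt_le_trans r10) // (le_trans r1a).
by field.
Qed.

End flux.

End circle_means.

(** * Goursat's theorem in polar coordinates and constancy of circle means *)

Section mean_value.
Context {R : realType}.
Local Notation C := (complexField R).
Implicit Types (h : C -> C) (z w : C) (r t a b c d e : R).
Local Notation "'integral' a b f" := (\int[@lebesgue_measure R]_(x in `[a, b]) f x)
  (at level 10, a, b, f at level 9).

(** Near a point [h] differs from its first-order expansion, whose flux is zero, by a small multiple
    of the distance. The flux over a small polar rectangle is thus a small multiple of its squared
    size, as bisection requires. *)
Lemma sector_flux0 r1 r2 t1 t2 h : 0 < r1 -> r1 < r2 -> t1 < t2 ->
  (forall z, r1 <= modulus z <= r2 -> derivable h z 1) ->
  sector_flux h r1 r2 t1 t2 = 0.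
Proof.
move=> r10 r12 t12 dh.
have ch : continuous_on_annulus r1 r2 h by move=> z /dh dz; exact: (derivable_continuous dz).
apply: goursat_bisection => //.
- move=> a b c d e r1a ab bc cr2 _ _ _; exact: (sector_flux_split_radius r10 _ _ ch).
- move=> a b c d e r1a ab br2 _ cd de _.
  by apply: (sector_flux_split_angle r10 ch) => //; exact: ltW.
move=> x y eps xr yt eps0; have /andP[r1x xr2] := xr.
have x0 : 0 < x by apply: lt_le_trans r1x.
have r20 : 0 < r2 by apply: lt_trans r12.
have dz0 : derivable h (polar x y) 1 by apply: dh; rewrite modulus_polar // ltW.
have hc0 := derivable_modulusP dz0; move: (h^`()%classic (polar x y)) hc0 => c0 hc0.
set z0 := polar x y in hc0.
(* On a rectangle with sum of sides [s] containing [(x, y)], points are within [A * s] of [z0]; a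
   bound [M] of the integrand bounds the flux by [B * M * s]. *)
pose A := 1 + 2 * r2; pose B := 2 * (1 + r1^-1).
have A0 : 0 < A by rewrite /A; lra.
have B0 : 0 < B by rewrite mulr_gt0 // addr_gt0 // invr_gt0.
have [|del del0 hdel] := hc0 (eps / (A * B)); first by rewrite divr_gt0 // mulr_gt0.
(* Two sides shorter than this give [A * s < del]. *)
exists (del / (2 * A)); first by rewrite divr_gt0 // mulr_gt0.
move=> a b c d r1a /andP[ax xb] br2 _ /andP[cy yd] _ ab cd ba dc.
set s := b - a + (d - c).
have s0 : 0 < s by rewrite /s; lra.
have As : A * s < del.
  have : s < 2 * (del / (2 * A)) by rewrite /s; lra.
  have -> : 2 * (del / (2 * A)) = del / A by field; rewrite gt_eqF.
  by rewrite ltr_pdivlMr // mulrC.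
pose k z := (h z0 - c0 * z0) + c0 * z.
have dk z : derivable k z 1.
  apply: derivableD; first exact: derivable_cst.
  by apply: derivableM; [exact: derivable_cst|exact: derivable_id].
have ck : continuous_on_annulus r1 r2 k by move=> z _; exact: (derivable_continuous (dk z)).
have k0 : sector_flux k a b c d = 0.
  by apply: (sector_flux_affine r10 (h z0 - c0 * z0) c0 r1a (ltW ab) br2 cd).
rewrite -[sector_flux h a b c d]subr0 -k0.
rewrite -(sector_fluxB r10 c d ch ck r1a (ltW ab) br2).
have chk : continuous_on_annulus r1 r2 (fun z => h z - k z).
  by move=> z /dh dz; apply: derivable_continuous; exact: (derivableB dz (dk z)).
pose M := eps / (A * B) * (A * s).
have hM r t : a <= r <= b -> c <= t <= d -> modulus (h (polar r t) - k (polar r t)) <= M.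
  move=> /andP[ar rb] /andP[ct td].
  have -> : h (polar r t) - k (polar r t)
      = h (polar r t) - h z0 - c0 * (polar r t - z0) by rewrite /k; ring.
  have near : modulus (polar r t - z0) <= A * s.
    apply: le_trans (modulus_polarB_le r t y (ltW x0)) _.
    have rx : `|r - x| <= s by rewrite ler_norml /s; apply/andP; split; lra.
    have ty : `|t - y| <= s by rewrite ler_norml /s; apply/andP; split; lra.
    have : 2 * x * `|t - y| <= 2 * r2 * s by apply: ler_pM => //; lra.
    rewrite /A mulrDl mul1r; lra.
  apply: le_trans (hdel _ _) _; first exact: le_lt_trans near As.
  by rewrite ler_wpM2l // divr_ge0 ?(ltW eps0) // mulr_ge0 // ltW.
apply: le_trans (sector_flux_le r10 chk r1a (ltW ab) br2 (ltW cd) hM) _.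
have -> : eps * s ^+ 2 = 2 * (M * s) + 2 * (M / r1 * s).
  by rewrite /M /B; field; rewrite !gt_eqF //= addr_gt0.
have M0 : 0 <= M.
  apply/ltW/mulr_gt0; last exact: mulr_gt0.
  by apply: divr_gt0 => //; exact: mulr_gt0.
have M1 : 0 <= M / r1 by rewrite divr_ge0 // ltW.
have d1 : d - c <= s by rewrite /s; lra.
have d2 : b - a <= s by rewrite /s; lra.
by apply: lerD; rewrite ler_pM2l //; exact: ler_wpM2l.
Qed.

(** Over a full turn the two radial sides are the same segment and cancel, so zero flux leaves the
    equality of the two circle integrals. *)
Lemma circle_mean_annulus r1 r2 h : 0 < r1 -> r1 <= r2 ->
  (forall z, r1 <= modulus z <= r2 -> derivable h z 1) ->
  integral 0 (2 * pi) (fun t => Re (h (polar r1 t)))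
  = integral 0 (2 * pi) (fun t => Re (h (polar r2 t))).
Proof.
move=> r10; rewrite le_eqVlt => /predU1P[->//|r12] dh.
have pi2 : (0 : R) < 2 * pi by rewrite mulr_gt0 // pi_gt0.
have := sector_flux0 r10 r12 pi2 dh; rewrite /sector_flux.
have polarE r : polar r (2 * pi) = polar r 0 :> C.
  by rewrite /polar mulr_natl cos2pi sin2pi cos0 sin0.
under [X in _ - (X - _)]eq_Rintegral do rewrite polarE.
by rewrite subrr subr0 => /eqP; rewrite subr_eq0 => /eqP ->.
Qed.

Lemma polar0 t : polar 0 t = 0 :> C.
Proof. by rewrite /polar !mul0r. Qed.

(** Uniformity in [t] comes from compactness of [[a, b]]: near each [t] both values lie within
    [e / 2] of [h (polar rho t)]. *)
Lemma near_circle_values rho h a b : (forall t, {for polar rho t, continuous h}) ->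
  forall e, 0 < e -> \forall r \near rho,
    forall t, a <= t <= b -> modulus (h (polar r t) - h (polar rho t)) < e.
Proof.
move=> ch e e0.
have /compact_near_coveringP cov := @segment_compact R a b.
pose P r t : Prop := modulus (h (polar r t) - h (polar rho t)) < e.
have near_t t : `[a, b]%classic t -> \forall t' \near t & r \near nbhs rho, P r t'.
  move=> _.
  have e2 : 0 < e / 2 by rewrite divr_gt0.
  have /cvg_modulusP/(_ _ e2) near_h := ch t.
  have c1 := @polar_continuous R (rho, t) _ near_h.
  have c2 := @polar_continuous_angle R rho t _ near_h.
  have c2' : \forall q \near (t, rho), modulus (h (polar rho q.1) - h (polar rho t)) < e / 2.
    exact: (@cvg_fst _ _ (nbhs t) (nbhs rho) _ _ c2).
  have c1' : \forall q \near (t, rho), modulus (h (polar q.2 q.1) - h (polar rho t)) < e / 2.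
    exact: (cvg_pair (@cvg_snd _ _ (nbhs t) (nbhs rho) _) (@cvg_fst _ _ (nbhs t) (nbhs rho) _) c1).
  near=> q; rewrite /P /=.
  have -> : h (polar q.2 q.1) - h (polar rho q.1) = (h (polar q.2 q.1) - h (polar rho t))
      + - (h (polar rho q.1) - h (polar rho t)) by rewrite opprB addrA subrK.
  apply: le_lt_trans (modulusD _ _) _; rewrite modulusN [e]splitr ltrD //.
    by near: q.
  by near: q.
apply: (filterS _ (cov R (nbhs rho) P _ near_t)) => r rP t tab.
by apply: rP; rewrite /= in_itv.
Unshelve. all: by end_near. Qed.

End mean_value.

(** * The mean value property with exceptional radii; [mean] is not divided by the length of the
    interval *)

Section mean_value_exceptional.
Context {R : realType}.
Local Notation C := (complexField R).
Implicit Types (h : C -> C) (z w : C) (r t a b c d e : R).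
Local Notation "'integral' a b f" := (\int[@lebesgue_measure R]_(x in `[a, b]) f x)
  (at level 10, a, b, f at level 9).
Local Notation mean h r := (integral 0 (2 * pi) (fun t => Re (h (polar r t)))).

Lemma circle_mean_continuous rho h r0 : 0 <= r0 <= rho ->
  continuous_on_annulus 0 rho h -> forall e, 0 < e ->
  exists2 d, 0 < d & forall r, 0 <= r <= rho -> `|r - r0| < d ->
    `|mean h r - mean h r0| <= e.
Proof.
move=> r0rho ch e e0.
have pi2 : (0 : R) < 2 * pi by rewrite mulr_gt0 // pi_gt0.
have e' : 0 < e / (2 * pi) by rewrite divr_gt0.
have cr0 t : {for polar r0 t, continuous h}.
  by apply: ch; rewrite modulus_polar //; case/andP: r0rho.
have /nbhs_ballP[d d0 dP] := @near_circle_values R r0 h 0 (2 * pi) cr0 _ e'.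
exists d => // r rrho rr0; rewrite -RintegralB //; last 2 first.
- exact/continuous_on_itv_integrable/(continuous_on_circle_Re (lexx 0) rrho ch).
- exact/continuous_on_itv_integrable/(continuous_on_circle_Re (lexx 0) r0rho ch).
have -> : e = e / (2 * pi) * (2 * pi - 0) by rewrite subr0 divfK // gt_eqF.
apply: Rintegral_itv_norm_le; first exact: ltW.
  move=> t tI; apply: cvgB; first exact: (continuous_on_circle_Re (lexx 0) rrho ch tI).
  exact: (continuous_on_circle_Re (lexx 0) r0rho ch tI).
have rb : ball r0 d r by rewrite /ball /= distrC.
move=> t tI; apply/ltW; apply: le_lt_trans (dP _ rb t tI).
by rewrite -ReB; exact: normr_Re_le.
Qed.

(** The mean is constant on slightly smaller closed annuli, and its continuity in the radius carries
    this to the two bounding circles. *)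
Lemma circle_mean_open_annulus a b h : 0 <= a -> a < b ->
  continuous_on_annulus 0 b h ->
  (forall z, a < modulus z < b -> derivable h z 1) -> mean h a = mean h b.
Proof.
move=> a0 ab ch dh; apply/eqP; rewrite -subr_eq0 -normr_le0.
apply/ler_addgt0Pr => e e0; rewrite add0r.
have e2 : 0 < e / 2 by rewrite divr_gt0.
have b0 : 0 <= b by rewrite (le_trans a0) // ltW.
have ha : 0 <= a <= b by rewrite a0 ltW.
have hb : 0 <= b <= b by rewrite b0 lexx.
have [d1 d10 h1] := circle_mean_continuous ha ch e2.
have [d2 d20 h2] := circle_mean_continuous hb ch e2.
(* A third of the smallest margin keeps [a + eta] below [b - eta] and both radii within the
   continuity ranges. *)
pose eta := Num.min (Num.min d1 d2) (b - a) / 3.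
have [n0 n1 n2 n3] : [/\ 0 < eta, 3 * eta <= d1, 3 * eta <= d2 & 3 * eta <= b - a].
  rewrite /eta [3 * _]mulrC divfK //.
  split; rewrite ?ge_min ?lexx ?orbT //.
  by apply: divr_gt0 => //; rewrite !lt_min d10 d20 subr_gt0 ab.
have := h1 (a + eta); have := h2 (b - eta).
have -> : mean h (b - eta) = mean h (a + eta).
  apply/esym; apply: circle_mean_annulus; [lra|lra|].
  by move=> z /andP[z1 z2]; apply: dh; apply/andP; split; lra.
have -> : `|b - eta - b| = eta by rewrite addrAC subrr add0r normrN gtr0_norm.
have -> : `|a + eta - a| = eta by rewrite addrAC subrr add0r gtr0_norm.
move=> H2 H1.
have {}H2 : `|mean h (a + eta) - mean h b| <= e / 2.
  by apply: H2; [apply/andP; split; lra|lra].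
have {}H1 : `|mean h (a + eta) - mean h a| <= e / 2.
  by apply: H1; [apply/andP; split; lra|lra].
have := ler_distD (mean h (a + eta)) (mean h a) (mean h b).
rewrite [X in _ <= X + _]distrC; lra.
Qed.

(** The mean is constant for radii from 0 to [modulus w] and from there to [rho]; at radius 0 the
    circle degenerates to a point. *)
Lemma circle_mean_value rho h w : 0 < rho -> continuous_on_annulus 0 rho h ->
  (forall z, modulus z < rho -> z != 0 -> z != w -> derivable h z 1) ->
  mean h rho = 2 * pi * Re (h 0).
Proof.
move=> rho0 ch dh.
have <- : mean h 0 = 2 * pi * Re (h 0).
  under eq_Rintegral do rewrite polar0.
  by rewrite Rintegral_itv_cst ?subr0 1?mulrC // mulr_ge0 // pi_ge0.
have dh' z : modulus z < rho -> modulus z != 0 -> modulus z != modulus w -> derivable h z 1.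
  move=> zr z0 zw; apply: dh => //; first by rewrite -modulus_eq0.
  by apply: contraNneq zw => ->.
(* If [w] is 0 or lies outside the open disc, no circle strictly between 0 and [rho] is exceptional,
   and one annulus is enough. *)
have [w0|] := boolP (0 < modulus w < rho); last first.
  move=> nw; apply/esym; apply: circle_mean_open_annulus => // z /andP[z0 zr].
  apply: dh' => //; first by rewrite gt_eqF.
  by apply: contraNneq nw => <-; rewrite z0.
have /andP[w1 w2] := w0.
have chw : continuous_on_annulus 0 (modulus w) h.
  by move=> z /andP[z1 z2]; apply: ch; rewrite z1 (le_trans z2) // ltW.
transitivity (mean h (modulus w)); apply/esym.
  apply: (circle_mean_open_annulus (modulus_ge0 w) w2 ch) => z /andP[z0 zr].
  apply: dh' => //; last by rewrite gt_eqF.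
  by rewrite gt_eqF // (le_lt_trans (modulus_ge0 w)).
apply: circle_mean_open_annulus => // z /andP[z0 zr]; apply: dh' => //.
- exact: lt_trans w2.
- by rewrite gt_eqF.
- by rewrite lt_eqF.
Qed.

End mean_value_exceptional.

(** * The Poisson formula and Harnack's inequality *)

Lemma near_eq_continuous (T U : topologicalType) (f g : T -> U) (x : T) :
  {near x, f =1 g} -> {for x, continuous f} -> {for x, continuous g}.
Proof.
move=> fg cf; rewrite /prop_for /continuous_at -(nbhs_singleton fg).
by apply: cvg_trans cf; exact: near_eq_cvg.
Qed.

Section harnack.
Context {R : realType}.
Local Notation C := (complexField R).
Implicit Types (G h : C -> C) (z w c : C) (r t : R).
Local Notation "'integral' a b f" := (\int[@lebesgue_measure R]_(x in `[a, b]) f x)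
  (at level 10, a, b, f at level 9).
Local Notation mean h r := (integral 0 (2 * pi) (fun t => Re (h (polar r t)))).

Lemma Re_div z w : Re (z / w) = (Re z * Re w + Im z * Im w) / modulus w ^+ 2.
Proof. by rewrite modulus_sq; case: z w => x y [p q] /=; ring. Qed.

Lemma ReM_real z (x : R) : Re (z * (x%:C%C : C)) = Re z * x.
Proof. by case: z => p q /=; ring. Qed.

Lemma mul_conjc z : z * conjc z = ((modulus z ^+ 2)%:C%C : C).
Proof.
rewrite modulus_sq; case: z => x y; apply/eqP; rewrite eq_complex /=.
by apply/andP; split; apply/eqP; ring.
Qed.

Lemma conjcB z w : conjc (z - w) = conjc z - conjc w :> C.
Proof. exact: (raddfB (@conjc R : {additive R[i] -> R[i]})). Qed.

Section kernel.
Variables (w : C) (rho : R).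
Hypotheses (w0 : w != 0) (wrho : modulus w < rho).

Let rho0 : 0 < rho. Proof. exact: le_lt_trans (modulus_ge0 w) wrho. Qed.

Let poisson_den z : C := ((rho ^+ 2)%:C%C : C) - conjc w * z.

(** The product [conjc w * z] has modulus at most [modulus w * rho], strictly less than
    [rho ^+ 2]. *)
Let poisson_den_neq0 z : modulus z <= rho -> poisson_den z != 0.
Proof.
move=> zrho; apply/negP; rewrite /poisson_den subr_eq0 => /eqP E.
have := congr1 modulus E; rewrite modulusM modulus_real ger0_norm ?sqr_ge0 //.
have -> : modulus (conjc w) = modulus w.
  by case: (w) => x y; rewrite /modulus /= sqrrN.
have : modulus w * modulus z <= modulus w * rho by rewrite ler_wpM2l ?modulus_ge0.
have : modulus w * rho < rho * rho by rewrite ltr_pM2r.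
rewrite expr2; lra.
Qed.

Let derivable_poisson_den z : derivable poisson_den z 1.
Proof.
apply: derivableB; first exact: derivable_cst.
by apply: derivableM; [exact: derivable_cst|exact: derivable_id].
Qed.

Let derivable_div (f g : C -> C) z : derivable f z 1 -> derivable g z 1 -> g z != 0 ->
  derivable (fun z => f z / g z) z 1.
Proof. by move=> df dg g0; exact: (derivableM df (derivableV g0 dg)). Qed.

Definition poisson_kernel t : R :=
  (rho ^+ 2 - modulus w ^+ 2) / modulus (polar rho t - w) ^+ 2.

Lemma polar_sub_neq0 t : polar rho t - w != 0.
Proof.
rewrite subr_eq0; apply: contraTneq wrho => <-.
by rewrite modulus_polar ?ltxx // ltW.
Qed.

(** The Poisson kernel is the real part of [herglotz] on the circle. *)
Let herglotz z : C := (((rho ^+ 2)%:C%C : C) + conjc w * z) / poisson_den z.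

Let derivable_herglotz z : modulus z <= rho -> derivable herglotz z 1.
Proof.
move=> zrho; pose f z : C := ((rho ^+ 2)%:C%C : C) + conjc w * z.
have df : derivable f z 1.
  apply: derivableD; first exact: derivable_cst.
  by apply: derivableM; [exact: derivable_cst|exact: derivable_id].
exact: (derivable_div df (@derivable_poisson_den z) (poisson_den_neq0 zrho)).
Qed.

Let continuous_herglotz : continuous_on_annulus 0 rho herglotz.
Proof. by move=> z /andP[_ zr]; apply: derivable_continuous; exact: derivable_herglotz. Qed.

Let Re_herglotz t : Re (herglotz (polar rho t)) = poisson_kernel t.
Proof.
have m0 : modulus (polar rho t - w) ^+ 2 != 0.
  by rewrite expf_neq0 // modulus_eq0 polar_sub_neq0.
have d0 : modulus (poisson_den (polar rho t)) ^+ 2 != 0.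
  by rewrite expf_neq0 // modulus_eq0 poisson_den_neq0 // modulus_polar // ltW.
have := modulus_sq (polar rho t); rewrite modulus_polar ?(ltW rho0) //.
move: m0 d0; rewrite /poisson_kernel /herglotz Re_div !modulus_sq /poisson_den.
case: (w) (polar rho t) => p q [x y] /=; rewrite !(addr0, add0r, mul0r, subr0).
(* On the circle [rho ^+ 2] equals [x ^+ 2 + y ^+ 2]; after this substitution, cross-multiplying
   leaves a polynomial identity. *)
move=> m0 d0 E; rewrite E in d0 *.
apply/eqP; rewrite eqr_div //; apply/eqP; ring.
Qed.

Lemma continuous_poisson_kernel a b : continuous_on_itv a b poisson_kernel.
Proof.
have hr : 0 <= rho <= rho by rewrite lexx ltW.
have := @continuous_on_circle_Re R 0 rho _ _ a b (lexx 0) hr continuous_herglotz.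
by under [X in continuous_on_itv _ _ X -> _]eq_fun do rewrite Re_herglotz.
Qed.

(** The mean value property applies to [herglotz], which takes the value 1 at the origin. *)
Lemma Rintegral_poisson_kernel : integral 0 (2 * pi) poisson_kernel = 2 * pi.
Proof.
transitivity (mean herglotz rho); first by apply: eq_Rintegral => t _; rewrite Re_herglotz.
(* The condition on [z] appears twice because 0 also serves as the exceptional point of
   [circle_mean_value]. *)
have dh z : modulus z < rho -> z != 0 -> z != 0 -> derivable herglotz z 1.
  by move=> /ltW zr _ _; exact: derivable_herglotz zr.
rewrite (circle_mean_value rho0 continuous_herglotz dh) /herglotz /poisson_den.
rewrite mulr0 addr0 subr0 divff ?mulr1 //.
by rewrite eq_complex /= eqxx andbT expf_neq0 // gt_eqF.
Qed.

(** The product [h] of the difference quotient of [G] at [w] with [s] vanishes at 0, so its mean is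
    zero; on the circle of radius [rho] it equals [G - G w] times the kernel. *)
Lemma poisson_formula G : {for 0, continuous G} ->
  (forall z, modulus z <= rho -> z != 0 -> derivable G z 1) ->
  integral 0 (2 * pi) (fun t => (Re (G (polar rho t)) - Re (G w)) * poisson_kernel t) = 0.
Proof.
move=> cG dG.
(* The derivative [c] of [G] at [w] fills the gap of the difference quotient; it exists because [w]
   is not 0. *)
have hc := derivable_modulusP (dG w (ltW wrho) w0).
move: (G^`()%classic w) hc => c hc.
pose q z := if z == w then c else (G z - G w) / (z - w).
pose s z := z * (((rho ^+ 2 - modulus w ^+ 2)%:C%C : C) / poisson_den z).
pose h z := q z * s z.
have ds z : modulus z <= rho -> derivable s z 1.
  move=> zr; pose k : C := ((rho ^+ 2 - modulus w ^+ 2)%:C)%C.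
  have dk : derivable (fun=> k) z 1 by exact: derivable_cst.
  have H := derivable_div dk (@derivable_poisson_den z) (poisson_den_neq0 zr).
  have did : derivable (@id C) z 1 by exact: derivable_id.
  exact: (derivableM did H).
have qE z : z != w -> {near z, (fun z => (G z - G w) / (z - w)) =1 q}.
  move=> zw; apply/nbhs_modulusP; exists (modulus (z - w)).
    by rewrite modulus_gt0 subr_eq0.
  move=> y yz; rewrite /q ifF //; apply/negP => /eqP yw.
  by move: yz; rewrite yw modulusBC ltxx.
have derivable_subw z : derivable (fun z => z - w) z 1.
  have dc : derivable (fun=> w) z 1 by exact: derivable_cst.
  have did : derivable (@id C) z 1 by exact: derivable_id.
  exact: (derivableB did dc).
have dq z : modulus z <= rho -> z != 0 -> z != w -> derivable q z 1.
  move=> zr z0 zw; apply: near_eq_derivable (qE z zw) _.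
  have dzw : z - w != 0 by rewrite subr_eq0.
  have d1 : derivable (fun z => G z - G w) z 1.
    have dc : derivable (fun=> G w) z 1 by exact: derivable_cst.
    exact: (derivableB (dG z zr z0) dc).
  exact: (derivable_div d1 (@derivable_subw z) dzw).
have cq0 : {for 0, continuous q}.
  have w0' : 0 != w by rewrite eq_sym.
  apply: near_eq_continuous (qE 0 w0') _.
  have d0 : 0 - w != 0 by rewrite subr_eq0.
  have c1 : {for 0, continuous (fun z => G z - G w)}.
    exact: (continuousB cG (@cst_continuous _ _ (G w) 0)).
  have c2 : {for 0, continuous (fun z => z - w)}.
    exact: (derivable_continuous (@derivable_subw 0)).
  exact: (continuousM c1 (@continuousV C C (fun z => z - w) 0 d0 c2)).
have cqw : {for w, continuous q}.
  apply/(@cvg_modulusP R C (nbhs w)) => e e0.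
  have e2 : 0 < e / 2 by rewrite divr_gt0.
  have [d d0 dP] := hc _ e2.
  apply/nbhs_modulusP; exists d => // z zw; rewrite /q eqxx.
  have [_|zw0] := eqVneq z w; first by rewrite subrr modulus0.
  have m0 : 0 < modulus (z - w) by rewrite modulus_gt0 subr_eq0.
  have -> : (G z - G w) / (z - w) - c = (G z - G w - c * (z - w)) / (z - w).
    by rewrite [RHS]mulrBl mulfK // subr_eq0.
  rewrite modulusM modulusV ltr_pdivrMr //; apply: le_lt_trans (dP _ zw) _.
  by rewrite ltr_pM2r // ltr_pdivrMr // ltr_pMr // ltr1n.
have ch : continuous_on_annulus 0 rho h.
  move=> z /andP[_ zr].
  have cs : {for z, continuous s} := derivable_continuous (ds z zr).
  suff cq : {for z, continuous q} by exact: (continuousM cq cs).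
  have [->|z0] := eqVneq z 0; first exact: cq0.
  have [->|zw] := eqVneq z w; first exact: cqw.
  exact: (derivable_continuous (dq z zr z0 zw)).
have dh z : modulus z < rho -> z != 0 -> z != w -> derivable h z 1.
  by move=> /ltW zr z0 zw; exact: (derivableM (dq z zr z0 zw) (ds z zr)).
have h0 : h 0 = 0 by rewrite /h /s mul0r mulr0.
have := circle_mean_value rho0 ch dh; rewrite h0 mulr0 => mean0.
rewrite -[RHS]mean0; apply: eq_Rintegral => t _; rewrite -ReB -ReM_real; congr Re.
set z := polar rho t.
have zw : z - w != 0 by exact: polar_sub_neq0.
have zw' : conjc (z - w) != 0 by rewrite conjc_eq0.
have z0 : z != 0 by rewrite -modulus_eq0 modulus_polar ?gt_eqF // ltW.
(* On the circle [rho ^+ 2] is [z] times its conjugate, so the denominators combine into [z] times a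
   squared modulus, and the factor [z] of [s] cancels. *)
have denE : poisson_den z = z * conjc (z - w).
  have rhoE : ((rho ^+ 2)%:C%C : C) = z * conjc z.
    by rewrite mul_conjc modulus_polar // ltW.
  by rewrite /poisson_den rhoE conjcB; ring.
rewrite /h /q /s ifF; last by apply/negP => /eqP E; rewrite E subrr eqxx in zw.
rewrite denE /poisson_kernel rmorphM fmorphV /= -mul_conjc.
rewrite -/z; move: (conjc (z - w)) zw' => zc zc0.
by field; rewrite zw zc0 z0.
Qed.


(** The distance from [w] to the circle point is at most [rho + modulus w], a factor of the
    numerator. *)
Lemma poisson_kernel_ge t : (rho - modulus w) / (rho + modulus w) <= poisson_kernel t.
Proof.
have m0 : 0 < modulus (polar rho t - w) by rewrite modulus_gt0 polar_sub_neq0.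
have m1 : modulus (polar rho t - w) <= rho + modulus w.
  by apply: le_trans (modulusD _ _) _; rewrite modulusN modulus_polar // ltW.
have wr : 0 < rho + modulus w by rewrite ltr_wpDr ?modulus_ge0.
rewrite /poisson_kernel ler_pdivlMr ?exprn_gt0 // subr_sqr.
rewrite -mulrA ler_wpM2l ?subr_ge0 ?(ltW wrho) // mulrC ler_pdivrMr // -expr2.
by rewrite ler_pXn2r // ?nnegrE ltW.
Qed.

End kernel.

(** Since [Re G] is nonnegative on the circle, the kernel may be replaced by its lower bound [k];
    integrating gives [k] times the mean of [G] against the Poisson formula for [Re (G w)]. *)
Lemma harnack_ge G w rho : modulus w < rho -> {for 0, continuous G} ->
  (forall z, modulus z <= rho -> z != 0 -> derivable G z 1) ->
  (forall t, 0 <= Re (G (polar rho t))) ->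
  (rho - modulus w) / (rho + modulus w) * Re (G 0) <= Re (G w).
Proof.
move=> wrho cG dG G_ge0; have rho0 : 0 < rho := le_lt_trans (modulus_ge0 w) wrho.
have [->|w0] := eqVneq w 0.
  by rewrite modulus0 subr0 addr0 divff ?mul1r // gt_eqF.
have ch : continuous_on_annulus 0 rho G.
  move=> z /andP[_ zr]; have [->|z0] := eqVneq z 0; first exact: cG.
  exact: (derivable_continuous (dG z zr z0)).
have mean0 : mean G rho = 2 * pi * Re (G 0).
  apply: (@circle_mean_value R rho G 0 rho0 ch) => z /ltW zr z0 _.
  exact: dG zr z0.
have rr : 0 <= rho <= rho by rewrite lexx ltW.
have cU a b : continuous_on_itv a b (fun t => Re (G (polar rho t))).
  exact: continuous_on_circle_Re (lexx 0) rr ch.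
have cP a b := @continuous_poisson_kernel w rho wrho a b.
have iU := continuous_on_itv_integrable (cU 0 (2 * pi)).
have iP := continuous_on_itv_integrable (cP 0 (2 * pi)).
set k := (rho - modulus w) / (rho + modulus w).
(* The term with [Re (G w)] is subtracted on both sides, so that the larger integral vanishes by the
   Poisson formula. *)
have cL : continuous_on_itv 0 (2 * pi)
    (fun t => k * Re (G (polar rho t)) - Re (G w) * poisson_kernel w rho t).
  move=> t tI; apply: cvgB; apply: cvgM; try exact: cvg_cst.
    exact: cU tI.
  exact: cP tI.
have cRt : continuous_on_itv 0 (2 * pi)
    (fun t => (Re (G (polar rho t)) - Re (G w)) * poisson_kernel w rho t).
  move=> t tI; apply: cvgM; last exact: cP tI.
  by apply: cvgB; [exact: cU tI|exact: cvg_cst].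
have := le_Rintegral_itv cL cRt; rewrite (poisson_formula w0 wrho cG dG).
have -> : integral 0 (2 * pi)
    (fun t => k * Re (G (polar rho t)) - Re (G w) * poisson_kernel w rho t)
    = k * mean G rho - Re (G w) * (2 * pi).
  have cU' : continuous_on_itv 0 (2 * pi) (fun t => k * Re (G (polar rho t))).
    by move=> t tI; apply: cvgM; [exact: cvg_cst|exact: cU tI].
  have cP' : continuous_on_itv 0 (2 * pi) (fun t => Re (G w) * poisson_kernel w rho t).
    by move=> t tI; apply: cvgM; [exact: cvg_cst|exact: cP tI].
  rewrite RintegralB //; try exact: continuous_on_itv_integrable.
  have mI : measurable (`[0, 2 * pi]%classic : set R) by exact: measurable_itv.
  congr (_ - _); first exact: RintegralZl iU.
  transitivity (Re (G w) * integral 0 (2 * pi) (poisson_kernel w rho)).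
    exact: RintegralZl iP.
  by rewrite Rintegral_poisson_kernel.
rewrite mean0 subr_le0 => H.
have pi2 : (0 : R) < 2 * pi by rewrite mulr_gt0 // pi_gt0.
rewrite -(ler_pM2l pi2) [leRHS]mulrC mulrCA; apply: H => t _.
by rewrite mulrBl lerD2r mulrC ler_wpM2l //; exact: poisson_kernel_ge.
Qed.

End harnack.

(** * Growth of centred inner functions *)

Section schwarz_growth.
Context {R : realType}.
Local Notation C := (complexField R).

Lemma exists_phase (v : C) :
  exists2 beta : C, modulus beta = 1 & beta * v = ((modulus v)%:C%C : C).
Proof.
have [->|v0] := eqVneq v 0.
  by exists 1; rewrite ?mulr0 ?modulus0 // /modulus ComplexField.Normc.normc1.
exists (((modulus v)%:C%C : C) / v); last by rewrite divfK.
rewrite modulusM modulusV modulus_real ger0_norm ?modulus_ge0 //.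
by rewrite divff // modulus_eq0.
Qed.

Lemma closure_unit_disc (z : C) : closure unit_disc z -> modulus z <= 1.
Proof.
move=> cz; rewrite leNgt; apply/negP => z1.
have e0 : 0 < modulus z - 1 by rewrite subr_gt0.
have [|w [/= w1 wz]] := cz [set w | modulus (w - z) < modulus z - 1].
  by apply/nbhs_modulusP; exists (modulus z - 1).
have := modulusD w (z - w); rewrite addrC subrK modulusBC.
by rewrite /unit_disc /= in w1; lra.
Qed.

(** The quotient [g] of [f] by the identity, completed at 0 by the derivative, is bounded by
    [rho^-1] on the circle of radius [rho]. Harnack's inequality for [rho^-1 - beta * g] then
    transfers the gap at 0, at least [rho^-1 - l], to [z]. *)
Lemma schwarz_growth (f : C -> C) (l : R) (z : C) : analytic_on_disc f ->
  (forall y, unit_disc y -> modulus (f y) <= 1) -> f 0 = 0 ->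
  modulus (f^`()%classic 0) <= l -> l < 1 -> unit_disc z ->
  modulus (f z) <= modulus z * (1 - (1 - l) * (1 - modulus z) / (1 + modulus z)).
Proof.
move=> af f1 f0 fl l1; rewrite /unit_disc /= => z1.
have [->|z0] := eqVneq z 0; first by rewrite f0 modulus0 mul0r.
pose g y := if y == 0 then f^`()%classic 0 else f y / y.
have gE y : y != 0 -> {near y, (fun x => f x / x) =1 g}.
  move=> y0; apply/nbhs_modulusP; exists (modulus y); first by rewrite modulus_gt0.
  move=> x xy; rewrite /g ifF //; apply/negP => /eqP x0.
  by move: xy; rewrite x0 sub0r modulusN ltxx.
have dg y : modulus y < 1 -> y != 0 -> derivable g y 1.
  move=> y1 y0; apply: near_eq_derivable (gE y y0) _.
  have did : derivable (@id C) y 1 by exact: derivable_id.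
  exact: (derivableM (af y y1) (@derivableV _ _ id y 1 y0 did)).
have cg : {for 0, continuous g}.
  apply/(@cvg_modulusP R C (nbhs 0)) => e e0.
  have e2 : 0 < e / 2 by rewrite divr_gt0.
  have D0 : unit_disc (0 : C) by rewrite /unit_disc /mkset modulus0 ltr01.
  have [d d0 dP] := derivable_modulusP (af 0 D0) e2.
  apply/nbhs_modulusP; exists d => // y y0; rewrite /g eqxx.
  have [_|yn0] := eqVneq y 0; first by rewrite subrr modulus0.
  have m0 : 0 < modulus y by rewrite modulus_gt0.
  have := dP y y0; rewrite f0 !subr0 => H.
  have -> : f y / y - f^`()%classic 0 = (f y - f^`()%classic 0 * y) / y.
    by rewrite [RHS]mulrBl mulfK.
  rewrite modulusM modulusV ltr_pdivrMr //; apply: le_lt_trans H _.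
  by rewrite ltr_pM2r // ltr_pdivrMr // ltr_pMr // ltr1n.
set x := modulus z in z1 *; have x0 : 0 < x by rewrite modulus_gt0.
pose v := modulus (g z).
have v0 : 0 <= v by exact: modulus_ge0.
have fv : modulus (f z) = x * v.
  rewrite /v /g (negbTE z0) modulusM modulusV -/x mulrC divfK //.
  by rewrite gt_eqF.
(* This is Harnack's inequality multiplied by [rho * (rho + x)]: without division, the passage to
   [rho = 1] is polynomial. *)
have bound rho : x < rho -> rho < 1 ->
    0 <= (rho + x) - (rho - x) * (1 - l * rho) - v * rho * (rho + x).
  move=> xrho rho1; have rho0 : 0 < rho by apply: lt_trans xrho.
  (* The rotation [beta] makes the real part of [beta * g] at [z] equal to the full modulus [v]. *)
  have [beta b1 bv] := exists_phase (g z).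
  pose G y := ((rho^-1)%:C%C : C) - beta * g y.
  have dG y : modulus y <= rho -> y != 0 -> derivable G y 1.
    move=> yr y0; have dgy := dg y (le_lt_trans yr rho1) y0.
    have dc1 : derivable (fun=> ((rho^-1)%:C%C : C)) y 1 by exact: derivable_cst.
    have dc2 : derivable (fun=> beta) y 1 by exact: derivable_cst.
    exact: (derivableB dc1 (derivableM dc2 dgy)).
  have cG : {for 0, continuous G}.
    have cb := @cst_continuous C C beta 0.
    have cr := @cst_continuous C C ((rho^-1)%:C%C : C) 0.
    exact: (continuousB cr (continuousM cb cg)).
  have ReG y : Re (G y) = rho^-1 - Re (beta * g y) by rewrite ReB.
  have Re_le y : Re (beta * g y) <= modulus (g y).
    apply: le_trans (ler_norm _) _; apply: le_trans (normr_Re_le _) _.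
    by rewrite modulusM b1 mul1r.
  have Gpos t : 0 <= Re (G (polar rho t)).
    rewrite ReG subr_ge0; apply: le_trans (Re_le _) _.
    have pr : modulus (polar rho t) = rho by rewrite modulus_polar // ltW.
    have pn0 : polar rho t != 0 by rewrite -modulus_eq0 pr gt_eqF.
    rewrite /g (negbTE pn0) modulusM modulusV pr ler_piMl ?invr_ge0 ?(ltW rho0) //.
    by apply: f1; rewrite /unit_disc /mkset pr.
  have := harnack_ge xrho cG dG Gpos.
  rewrite !ReG bv /= -/v -/x => H.
  have g0 : Re (beta * g 0) <= l by apply: le_trans (Re_le 0) _; rewrite /g eqxx.
  have {}H : (rho - x) / (rho + x) * (rho^-1 - l) <= rho^-1 - v.
    apply: le_trans H; rewrite ler_wpM2l ?lerD2l ?lerN2 //.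
    by rewrite divr_ge0 ?subr_ge0 ?ltW // addr_gt0.
  have rx : 0 < rho * (rho + x) by rewrite mulr_gt0 ?addr_gt0.
  move: H; rewrite -(ler_pM2l rx).
  have -> : rho * (rho + x) * ((rho - x) / (rho + x) * (rho^-1 - l))
     = (rho - x) * (1 - l * rho) by field; rewrite !gt_eqF // addr_gt0.
  have -> : rho * (rho + x) * (rho^-1 - v) = rho + x - v * rho * (rho + x).
    by field; rewrite gt_eqF.
  lra.
have l0 : 0 <= l by apply: le_trans fl; exact: modulus_ge0.
have bound1 : 0 <= (1 + x) - (1 - x) * (1 - l) - v * (1 + x).
  apply/ler_addgt0Pr => e e0.
  (* With [rho = 1 - t], the first bound keeps [rho] above [x]; the second absorbs the loss against
     [rho = 1], which is at most [3 * v * t]. *)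
  pose t := Num.min ((1 - x) / 2) (e / (3 * v + 1)).
  have v3 : 0 < 3 * v + 1 by lra.
  have t0 : 0 < t by rewrite lt_min !divr_gt0 // subr_gt0.
  have t1 : t <= (1 - x) / 2 by rewrite ge_min lexx.
  have t2 : t * (3 * v + 1) <= e by rewrite -ler_pdivlMr // ge_min lexx orbT.
  have := bound (1 - t) ltac:(lra) ltac:(lra).
  have p1 : 0 <= t * l * (1 - t) by rewrite !mulr_ge0 ?subr_ge0 ?(ltW t0) //; lra.
  have p2 : 0 <= t * l * (1 - x) by rewrite !mulr_ge0 ?subr_ge0 ?(ltW t0) ?(ltW z1).
  have p3 : 0 <= t * v * (1 - x) by rewrite !mulr_ge0 ?subr_ge0 ?(ltW t0) ?(ltW z1).
  have p4 : 0 <= v * t * t by rewrite !mulr_ge0 ?(ltW t0).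
  lra.
rewrite fv ler_pM2l //.
have x1 : 0 < 1 + x by lra.
rewrite -subr_ge0.
have -> : 1 - (1 - l) * (1 - x) / (1 + x) - v =
  ((1 + x) - (1 - x) * (1 - l) - v * (1 + x)) / (1 + x) by field; rewrite gt_eqF.
by rewrite divr_ge0 // ltW.
Qed.

End schwarz_growth.

(** * The real inequality behind the exponent [2 / a + 1] *)

Section contraction.
Context {R : realType}.
Implicit Types a l p u x y : R.

(** The convexity bound [1 + s <= exp s] is used twice: at [- ln u] for [1 - u^-1 <= ln u], and at
    [p * ln u]. *)
Lemma powR_ge_tangent u p : 0 < u -> 0 <= p -> 1 + (1 - u^-1) * p <= u `^ p.
Proof.
move=> u0 p0; have := expR_ge1Dx (- ln u).
rewrite expRN lnK ?posrE // => lnu.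
rewrite -{2}[u]lnK ?posrE // -expRM; apply: le_trans (expR_ge1Dx _).
by rewrite lerD2l ler_wpM2r //; lra.
Qed.

(** As [x / (1 - x) ^ p] increases, [y] may be replaced by its bound [x * B]. Since [1 - x * B]
    factors as [(1 - x) * u], the claim reduces to [B <= l * u ^ p]. *)
Lemma contraction_le a l x y : 0 < a -> a <= l -> l < 1 -> 0 <= x -> x < 1 -> 0 <= y ->
  y <= x * (1 - (1 - l) * (1 - x) / (1 + x)) ->
  y < 1 /\ y / (1 - y) `^ (2 / a + 1) <= l * (x / (1 - x) `^ (2 / a + 1)).
Proof.
move=> a0 al l1 x0 x1 y0 yx; set p := 2 / a + 1.
have l0 : 0 < l by apply: lt_le_trans al.
have p0 : 0 < 2 / a by rewrite divr_gt0.
have x1' : 0 < 1 + x by lra.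
pose d := 1 + (2 - l) * x.
have d0 : 0 < d by rewrite ltr_wpDr // mulr_ge0 //; lra.
pose u := d / (1 + x); have u0 : 0 < u by rewrite divr_gt0.
pose B := 1 - (1 - l) * (1 - x) / (1 + x).
have B0 : 0 <= B.
  have -> : B = (l * (1 - x) + 2 * x) / (1 + x) by rewrite /B; field; rewrite gt_eqF.
  by rewrite divr_ge0 ?(ltW x1') // addr_ge0 // mulr_ge0 // ?subr_ge0 ltW.
have xB : 1 - x * B = (1 - x) * u by rewrite /B /u /d; field; rewrite gt_eqF.
have xBp : 0 < 1 - x * B by rewrite xB mulr_gt0 // subr_gt0.
have y1 : 0 < 1 - y by rewrite -/B in yx; lra.
split; first by rewrite -subr_gt0.
have pw0 : 0 < (1 - x) `^ p by rewrite powR_gt0 // subr_gt0.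
have Bu : B <= l * u `^ p.
  rewrite powRD; last by rewrite gt_eqF // addr_gt0.
  rewrite powRr1 ?(ltW u0) //.
  have := powR_ge_tangent u0 (ltW p0); set U := u `^ _ => HU.
  have A0 : 0 <= 1 - u^-1.
    rewrite subr_ge0 invf_le1 // /u ler_pdivlMr // mul1r /d lerD2l ler_peMl //; lra.
  (* For the exponent [(2 - l) / l] the tangent bound times [l * u] is exactly [B]; as [l >= a], the
     exponent [2 / a] is at least as large. *)
  have la : (2 - l) / l <= 2 / a.
    rewrite ler_pdivlMr // mulrAC ler_pdivrMr //; nra.
  have HU' : 1 + (1 - u^-1) * ((2 - l) / l) <= U.
    by apply: le_trans HU; rewrite lerD2l ler_wpM2l.
  have -> : B = l * ((1 + (1 - u^-1) * ((2 - l) / l)) * u).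
    by rewrite /B /u /d; field; rewrite -/d !gt_eqF.
  by rewrite ler_wpM2l ?(ltW l0) // ler_wpM2r // ltW.
apply: (@le_trans _ _ (x * B / (1 - x * B) `^ p)).
  apply: ler_pM => //; first by rewrite invr_ge0 powR_ge0.
  rewrite lef_pV2 ?posrE ?powR_gt0 //.
  apply: ge0_ler_powR; rewrite ?nnegrE ?(ltW y1) ?(ltW xBp) //.
    by rewrite ltW // addr_gt0.
  by rewrite lerD2l lerN2.
rewrite xB powRM ?(ltW u0) ?subr_ge0 ?(ltW x1) //.
have up0 : 0 < u `^ p by rewrite powR_gt0.
have -> : x * B / ((1 - x) `^ p * u `^ p) = (B / u `^ p) * (x / (1 - x) `^ p).
  by field; rewrite !gt_eqF.
apply: ler_wpM2r; first by rewrite divr_ge0 // ltW.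
by rewrite ler_pdivrMr.
Qed.

End contraction.

(** * Iteration of the contraction along the composition *)

Theorem theoremB (R : realType) (a : R) (ha0 : 0 < a) (ha1 : a < 1) :
  exists K : R, 0 < K /\
    forall (lambda : nat -> R) (f : nat -> complexField R -> complexField R),
      (forall n, (1 <= n)%N -> a <= lambda n < 1) ->
      (\prod_(1 <= k < n.+1) lambda k @[n --> \oo] --> (0 : R)) ->
      (forall n, (1 <= n)%N -> inner_function (f n) /\ centred (f n)) ->
      (forall n, (1 <= n)%N -> modulus ((f n)^`()%classic 0) <= lambda n) ->
      forall n, (1 <= n)%N -> forall z : complexField R, unit_disc z ->
        modulus (compose_upto f n z) <=
          K * \prod_(1 <= k < n.+1) lambda k *
          (modulus z / (1 - modulus z) `^ (2 / a + 1)).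
Proof.
exists 1; split => // lambda f lam _ fin fl n n1 z z1.
(* The induction starts at the identity with an empty product, and carries along that the iterate
   stays in the disc, where the growth estimate applies. *)
have main k : modulus (compose_upto f k z) < 1 /\
    modulus (compose_upto f k z) / (1 - modulus (compose_upto f k z)) `^ (2 / a + 1)
    <= \prod_(1 <= i < k.+1) lambda i * (modulus z / (1 - modulus z) `^ (2 / a + 1)).
  elim: k => [|k [IH1 IH2]]; first by rewrite big_geq // mul1r /=; split.
  have [[af fD _] f0] := fin k.+1 isT; have /andP[al l1] := lam k.+1 isT.
  have f1 y : unit_disc y -> modulus (f k.+1 y) <= 1.
    by move=> y1; apply: closure_unit_disc; apply: fD; exists y.
  have step := schwarz_growth af f1 f0 (fl k.+1 isT) l1 IH1.
  have [H1 H2] := contraction_le ha0 al l1 (modulus_ge0 _) IH1 (modulus_ge0 _) step.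
  split; first exact: H1.
  apply: le_trans H2 _; rewrite big_nat_recr //= [_ * lambda _]mulrC -mulrA.
  by rewrite ler_wpM2l // (le_trans (ltW ha0)).
have [F1 F2] := main n; rewrite mul1r; apply: le_trans F2.
set x := modulus (compose_upto f n z) in F1 *.
have x0 : 0 <= x by exact: modulus_ge0.
(* A base in [(0, 1]] raised to a nonnegative power is at most 1, so removing the denominator only
   decreases the left side. *)
rewrite ler_pdivlMr ?powR_gt0 ?subr_gt0 // ler_piMr //.
rewrite -[leRHS](powRr0 (1 - x)); apply: ger_powR.
  by apply/andP; split; lra.
by rewrite addr_ge0 // divr_ge0 // ltW.
Qed.
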